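(* Let $\mathbb{K}$ be a field of characteristic $0$, let $U$ be a nonempty finite set of integers, and let $k\ge 0$ be an integer with $2k\le |U|$. Let $P_U=\mathbb{K}[x_e \mid e\in\binom{U}{2}]$, let $\Phi_{U,k}=\sum_{M\in\mathcal{M}(U,k)}x^M\in P_U$ be the weighted generating function of matchings with $k$ edges in the complete graph on $U$, and let $A_{\Phi_{U,k}}=P_U/\operatorname{Ann}(\Phi_{U,k})$. Then the Artinian Gorenstein algebra $A_{\Phi_{U,k}}$ has the strong Lefschetz property with Lefschetz element (the image of) $l=\sum_{e\in\binom{U}{2}}x_e$.
   Context: For a set $U$ and an integer $j$, $\binom{U}{j}$ denotes the set of $j$-element subsets of $U$. The complete graph $K_U$ has vertex set $U$ and edge set $\binom{U}{2}$. A matching in $K_U$ is a set $M\subset\binom{U}{2}$ such that $e,e'\in M$ and $e\ne e'$ imply $e\cap e'=\emptyset$. $\mathcal{M}(U,k)$ is the set of matchings in $K_U$ with exactly $k$ edges. $P_U=\mathbb{K}[x_e\mid e\in\binom{U}{2}]$ is the polynomial ring with one variable of degree $1$ for each edge, and $x^M=\prod_{e\in M}x_e$. For a homogeneous polynomial $\Phi\in P_U$, $\operatorname{Ann}(\Phi)=\{f\in P_U\mid f(\partial)\Phi=0\}$, where $f(\partial)$ is the differential operator obtained from $f$ by substituting $\partial_e=\frac{\partial}{\partial x_e}$ for $x_e$ for every $e$. This is a homogeneous ideal, so the quotient $P_U/\operatorname{Ann}(\Phi)$ is graded; when $\Phi\neq 0$ has degree $s$, the quotient is concentrated in degrees $0,\dots,s$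 and is called an Artinian Gorenstein algebra with standard grading. A graded algebra $A=\bigoplus_{d=0}^{s}A^{(d)}$ with $A^{(d)}\ne 0$ for $0\le d\le s$ has the strong Lefschetz property with Lefschetz element $l\in A^{(1)}$ if the multiplication map $\times l^{s-2d}\colon A^{(d)}\to A^{(s-d)}$, $f\mapsto f\,l^{s-2d}$, is bijective for every integer $d\geq 0$ with $2d\le s$. (For $A_{\Phi_{U,k}}$ one has $s=k$.) *)

(* Defs.v *)
From HB Require Import structures.
From mathcomp Require Import all_boot all_order all_algebra.
From mathcomp Require Import zify finmap ssrcomplements mpoly.

Set Implicit Arguments.
Unset Strict Implicit.
Unset Printing Implicit Defensive.

Import GRing.Theory.
Local Open Scope ring_scope.
Local Open Scope quotient_scope.

Section GradedAlgebras.

Variables (K : fieldType) (A : comAlgType K).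

(* [gr d] is the homogeneous component of degree d, as a subset of A. *)
Definition is_subspace (V : A -> Prop) : Prop :=
  V 0 /\ forall (c : K) (a b : A), V a -> V b -> V (c *: a + b).

(* A = gr 0 (+) ... (+) gr s, the components of degree > s being zero. *)
Definition graded_upto (s : nat) (gr : nat -> A -> Prop) : Prop :=
  [/\ forall d, is_subspace (gr d),
      gr 0%N 1,
      forall d e a b, gr d a -> gr e b -> gr (d + e)%N (a * b),
      forall a, exists! c : {ffun 'I_s.+1 -> A},
        (forall d : 'I_s.+1, gr d (c d)) /\ a = \sum_(d < s.+1) c d
    & forall d a, (s < d)%N -> gr d a -> a = 0].

Definition bijective_between (V W : A -> Prop) (f : A -> A) : Prop :=
  [/\ forall a, V a -> W (f a),
      forall a b, V a -> V b -> f a = f b -> a = b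
    & forall b, W b -> exists2 a, V a & f a = b].

Definition strong_Lefschetz (s : nat) (gr : nat -> A -> Prop) (l : A) : Prop :=
  [/\ graded_upto s gr,
      forall d, (d <= s)%N -> exists2 a, gr d a & a != 0,
      gr 1%N l
    & forall d, (2 * d <= s)%N ->
        bijective_between (gr d) (gr (s - d)%N)
          (fun a => a * l ^+ (s - 2 * d)%N)].

End GradedAlgebras.

Section Annihilator.

Variables (K : fieldType) (n : nat).
Implicit Types f g p : {mpoly K[n]}.

(* f(d/dx_0, ..., d/dx_(n-1)) p *)
Definition diffop f p : {mpoly K[n]} :=
  \sum_(m <- msupp f) f@_m *: p^`M[m].

Lemma diffopwE k f p : (msize f <= k)%N ->
  diffop f p = \sum_(m : 'X_{1..n < k}) f@_m *: p^`M[m].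
Proof.
move=> lt_fk; pose P (m : 'X_{1..n < k}) := (val m) \in msupp f.
rewrite (bigID P) {}/P /= addrC big1 ?add0r; last first.
  by move=> m' /memN_msupp_eq0=> ->; rewrite scale0r.
rewrite /diffop (big_mksub 'X_{1..n < k}) //=; first exact/msupp_uniq.
by move=> m' /msize_mdeg_lt /leq_trans; apply.
Qed.

Definition rdiffop p f := diffop f p.

Lemma rdiffop_is_linear p : linear (rdiffop p).
Proof.
move=> c f g; rewrite /rdiffop; pose k := maxn (msize (c *: f + g)) (maxn (msize f) (msize g)).
have hfg : (msize (c *: f + g) <= k)%N by rewrite leq_maxl.
have hf : (msize f <= k)%N by rewrite /k !leq_max leqnn orbT.
have hg : (msize g <= k)%N by rewrite /k !leq_max leqnn !orbT.
rewrite !(diffopwE _ (k := k)) // scaler_sumr -big_split /=.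
by apply: eq_bigr => m _; rewrite mcoeffD mcoeffZ scalerDl scalerA.
Qed.

HB.instance Definition _ p :=
  GRing.isLinear.Build K {mpoly K[n]} {mpoly K[n]} _ (rdiffop p)
    (rdiffop_is_linear p).

Lemma diffopX m p : diffop 'X_[m] p = p^`M[m].
Proof. by rewrite /diffop msuppX big_seq1 mcoeffX eqxx scale1r. Qed.

Lemma diffopDl f g p : diffop (f + g) p = diffop f p + diffop g p.
Proof. exact: (raddfD (rdiffop p)). Qed.

Lemma diffopBl f g p : diffop (f - g) p = diffop f p - diffop g p.
Proof. exact: (raddfB (rdiffop p)). Qed.

Lemma diffopZl c f p : diffop (c *: f) p = c *: diffop f p.
Proof. exact: (linearZ_LR (rdiffop p)). Qed.

Lemma diffop0l p : diffop 0 p = 0.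
Proof. exact: (raddf0 (rdiffop p)). Qed.

Lemma diffop_suml (I : Type) (r : seq I) (F : I -> {mpoly K[n]}) p :
  diffop (\sum_(i <- r) F i) p = \sum_(i <- r) diffop (F i) p.
Proof. exact: (raddf_sum (rdiffop p)). Qed.

Lemma diffop0r f : diffop f 0 = 0.
Proof. by rewrite /diffop big1 // => m _; rewrite raddf0 scaler0. Qed.

Lemma diffop1 p : diffop 1 p = p.
Proof. by rewrite -mpolyX0 diffopX mderivm0m. Qed.

Lemma diffopM f g p : diffop (f * g) p = diffop f (diffop g p).
Proof.
rewrite {1}[f]mpolyE mulr_suml diffop_suml [RHS]/diffop.
apply: eq_bigr => m _; rewrite -scalerAl diffopZl; congr (_ *: _).
rewrite {1}[g]mpolyE mulr_sumr diffop_suml raddf_sum /=.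
apply: eq_bigr => m' _.
by rewrite -scalerAr diffopZl -mpolyXD diffopX mderivmZ addmC mderivmDm.
Qed.

Definition Ann p : {pred {mpoly K[n]}} := [pred f | diffop f p == 0].

Lemma Ann_idealr_closed p : p != 0 -> idealr_closed (Ann p).
Proof.
move=> nz_p; split; rewrite ?inE ?diffop0l ?diffop1 //.
move=> f g h; rewrite !inE => /eqP hg /eqP hh.
by rewrite diffopDl diffopM hg hh addr0 diffop0r.
Qed.

(* [Ann p] tagged by a proof of [p != 0], which makes it a proper ideal, as the
   library's quotient rings require. *)
Definition proper_Ann p & p != 0 : {pred {mpoly K[n]}} := Ann p.

HB.instance Definition _ p (nz_p : p != 0) :=
  isIdealr.Build {mpoly K[n]} (proper_Ann nz_p) (Ann_idealr_closed nz_p).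

Definition gorenstein_alg p (nz_p : p != 0) : Type :=
  {ideal_quot (proper_Ann nz_p)}.

End Annihilator.

Section GorensteinAlgebra.

Variables (K : fieldType) (n : nat) (p : {mpoly K[n]}) (nz_p : p != 0).

Notation A := (gorenstein_alg nz_p).
Notation Q := {ideal_quot (proper_Ann nz_p)}.

HB.instance Definition _ := GRing.ComNzRing.on A.

Definition gorenstein_pi (f : {mpoly K[n]}) : A := \pi_Q f.

Lemma gorenstein_pi_is_zmod_morphism : zmod_morphism gorenstein_pi.
Proof. exact: (raddfB (\pi_Q)). Qed.

Lemma gorenstein_pi_is_monoid_morphism : monoid_morphism gorenstein_pi.
Proof. by split; [exact: (rmorph1 (\pi_Q))|exact: (rmorphM (\pi_Q))]. Qed.

HB.instance Definition _ :=
  GRing.isZmodMorphism.Build {mpoly K[n]} A gorenstein_pi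
    gorenstein_pi_is_zmod_morphism.
HB.instance Definition _ :=
  GRing.isMonoidMorphism.Build {mpoly K[n]} A gorenstein_pi
    gorenstein_pi_is_monoid_morphism.

Lemma gorenstein_pi_surj (a : A) : exists f, a = gorenstein_pi f.
Proof. by exists (repr (a : Q)); rewrite /gorenstein_pi reprK. Qed.

Lemma gorenstein_pi_eq f g :
  (gorenstein_pi f == gorenstein_pi g) = (f - g \in Ann p).
Proof.
have -> : (f - g \in Ann p) = (f - g \in proper_Ann nz_p) by [].
by rewrite (Quotient.idealrBE (proper_Ann nz_p)).
Qed.

Definition gorenstein_scale (c : K) (a : A) : A := gorenstein_pi c%:MP * a.

Lemma gorenstein_scaleA c d a :
  gorenstein_scale c (gorenstein_scale d a) = gorenstein_scale (c * d) a.
Proof. by rewrite /gorenstein_scale mulrA mpolyCM rmorphM. Qed.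

Lemma gorenstein_scale1 : left_id 1 gorenstein_scale.
Proof. by move=> a; rewrite /gorenstein_scale mpolyC1 rmorph1 mul1r. Qed.

Lemma gorenstein_scaleDr : right_distributive gorenstein_scale +%R.
Proof. by move=> c a b; rewrite /gorenstein_scale mulrDr. Qed.

Lemma gorenstein_scaleDl a : {morph gorenstein_scale^~ a : c d / c + d}.
Proof. by move=> c d; rewrite /gorenstein_scale mpolyCD raddfD mulrDl. Qed.

HB.instance Definition _ :=
  GRing.Zmodule_isLmodule.Build K A
    gorenstein_scaleA gorenstein_scale1 gorenstein_scaleDr gorenstein_scaleDl.

Lemma gorenstein_scaleAl (c : K) (a b : A) : c *: (a * b) = (c *: a) * b.
Proof. exact: mulrA. Qed.

HB.instance Definition _ :=
  GRing.Lmodule_isLalgebra.Build K A gorenstein_scaleAl.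
HB.instance Definition _ := GRing.Lalgebra_isComAlgebra.Build K A.

Definition gorenstein_gr (d : nat) (a : A) : Prop :=
  exists2 f : {mpoly K[n]}, f \is d.-homog & a = gorenstein_pi f.

End GorensteinAlgebra.

Section Matchings.

Definition edge (V : finType) := {e : {set V} | #|e| == 2%N}.

HB.instance Definition _ (V : finType) := Finite.on (edge V).

Variable V : finType.

Definition is_matching (M : {set edge V}) : bool :=
  [forall e in M, forall e' in M,
     (e != e') ==> [disjoint (val e) & (val e')]].

Definition matchings (k : nat) : {set {set edge V}} :=
  [set M | is_matching M & #|M| == k].

Variable K : fieldType.

(* Variables are indexed by the edges, listed in their canonical enumeration. *)
Definition edge_var (e : edge V) : {mpoly K[#|{: edge V}|]} := 'X_(enum_rank e).

Definition matching_mon (M : {set edge V}) : {mpoly K[#|{: edge V}|]} :=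
  \prod_(e in M) edge_var e.

Definition matching_poly (k : nat) : {mpoly K[#|{: edge V}|]} :=
  \sum_(M in matchings k) matching_mon M.

Definition edge_sum : {mpoly K[#|{: edge V}|]} := \sum_(e : edge V) edge_var e.

(* A k-matching covers at most 2k vertices, so it extends while two vertices
   are left over. *)
Lemma exists_matching k :
  (2 * k <= #|V|)%N -> exists M, M \in matchings k.
Proof.
elim: k => [|k IHk] le_kV.
  exists set0; rewrite inE cards0 eqxx andbT.
  by apply/forall_inP => e; rewrite inE.
have [|M] := IHk; first by apply: leq_trans le_kV; rewrite leq_mul2l leqnSn orbT.
rewrite inE => /andP[/forall_inP matM /eqP cM].
pose C := \bigcup_(e in M) val e.
have cC : (#|C| <= 2 * k)%N.
  rewrite mulnC -cM -sum_nat_const /C.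
  apply: (big_ind2 (fun (X : {set V}) m => (#|X| <= m)%N)) => [|X m Y p hX hY|e _].
  - by rewrite cards0.
  - exact: leq_trans (leq_card_setU X Y) (leq_add hX hY).
  - by rewrite (eqP (valP e)).
have : (1 < #|~: C|)%N by have := cardsC C; lia.
case/card_gt1P => a [b [aC bC ab]].
have cab : #|[set a; b]| == 2%N by rewrite cards2 ab.
pose e0 : edge V := exist _ [set a; b] cab.
have dis e : e \in M -> [disjoint [set a; b] & val e].
  move=> eM; rewrite disjoint_subset; apply/subsetP => x; rewrite !inE => xab.
  have : x \in ~: C by case/orP: xab => /eqP->.
  by rewrite inE; apply: contra => xe; apply/bigcupP; exists e.
have e0M : e0 \notin M.
  apply/negP => /dis; rewrite -setI_eq0 => /eqP/setP/(_ a).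
  by rewrite !inE eqxx.
exists (e0 |: M); rewrite inE cardsU1 e0M cM eqxx andbT.
apply/forall_inP => e; rewrite in_setU1 => eM.
apply/forall_inP => e'; rewrite in_setU1 => e'M; apply/implyP => ee'.
case/orP: eM e'M ee' => [/eqP->|eM] /orP[/eqP->|e'M] ee'.
- by rewrite eqxx in ee'.
- exact: dis.
- by rewrite disjoint_sym; apply: dis.
- by have /forall_inP/(_ _ e'M)/implyP/(_ ee') := matM _ eM.
Qed.

Definition matching_mnm (M : {set edge V}) : 'X_{1..#|{: edge V}|} :=
  [multinom (enum_val i \in M : nat) | i < #|{: edge V}|].

Lemma matching_mnm_inj : injective matching_mnm.
Proof.
move=> M N /mnmP eqMN; apply/setP => e.
have := eqMN (enum_rank e); rewrite !mnmE enum_rankK.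
by case: (e \in M); case: (e \in N).
Qed.

Lemma matching_monE M : matching_mon M = 'X_[matching_mnm M].
Proof.
rewrite [RHS]mpolyXE_id /matching_mon (reindex (@enum_val _ {: edge V})) /=; last first.
  by apply: onW_bij; apply: enum_val_bij.
rewrite big_mkcond; apply: eq_bigr => i _; rewrite mnmE.
by rewrite /edge_var enum_valK; case: (enum_val i \in M).
Qed.

Lemma matching_poly_neq0 k : (2 * k <= #|V|)%N -> matching_poly k != 0.
Proof.
case/exists_matching => M kM; apply/negP => /eqP/mpolyP/(_ (matching_mnm M)).
rewrite mcoeff0 raddf_sum (bigD1 M) //= big1 => [|N /andP[_ neNM]].
  by rewrite addr0 matching_monE mcoeffX eqxx => /eqP; rewrite oner_eq0.
by rewrite matching_monE mcoeffX (inj_eq matching_mnm_inj) (negPf neNM).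
Qed.

End Matchings.

(* Main.v *)
From HB Require Import structures.
Require Import Defs.
From mathcomp Require Import all_boot all_order all_algebra.
From mathcomp Require Import zify finmap mpoly.

(** The algebra is self-dual through the functional that sends h to the
    constant term of h(D)Phi_k, where D stands for the partial derivatives. As
    Phi_k is squarefree with coefficients 1, this
    functional sums the coefficients of h at the monomials of the k-matchings
    ([mcoeff0_diffop]), and in characteristic 0 a polynomial annihilates Phi_k
    exactly when all its monomial multiples are sent to 0 ([in_AnnP]).

    Three observations give the Lefschetz property.

    - The operator l(D) sends Phi_(j+1) to a multiple of Phi_j: a j-matching M
      extends by any edge that avoids the 2j vertices of M, and there are
      binomial(|U| - 2j, 2) of these whatever M is
      ([matching_functional_mul_edge_sum]). So pairing two elements of degree d
      through l^(k-2d) is, up to a nonzero constant, pairing them in the algebra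
      of Phi_(2d), without any power of l.

    - The pairing of the monomials of a d-matching and of a j-matching in the
      algebra of Phi_(d+j) is 1 if their vertex sets are disjoint, and 0
      otherwise ([matching_functional_mulX]). It depends on the vertex sets
      only, and every 2d-set of vertices is the vertex set of a d-matching.

    - The matrix of disjointness between the 2d-subsets of U is invertible in
      characteristic 0, because 4d <= 2k <= |U|; the inverse is explicit
      ([disjointness_invP]).

    If f of degree d is killed by l^(k-2d), then by the first two points the sums
    F S of the coefficients of f over the d-matchings with vertex set S form a
    kernel vector of that matrix, so F = 0; all pairings of f with
    (k-d)-matchings are sums of values of F, hence f = 0 in the algebra
    ([mul_edge_sum_inj]). Conversely an element of degree k - d is determined by
    its pairings with d-matchings, and these can be prescribed on the image of
    l^(k-2d) by solving a linear system with the same matrix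
    ([mul_edge_sum_surj]). *)

Set Implicit Arguments.
Unset Strict Implicit.
Unset Printing Implicit Defensive.

Import GRing.Theory.
Local Open Scope ring_scope.

(** * Inverting the disjointness matrix of the a-subsets *)

Section DisjointnessMatrix.

Variables (K : fieldType) (T : finType).
Implicit Types A B C : {set T}.

(** Grouping the B by size gives the binomial expansion of (1 - 1)^|A|. *)
Lemma sum_signed_subsets A :
  \sum_(B : {set T} | B \subset A) (-1) ^+ #|B| = (A == set0)%:R :> K.
Proof.
rewrite (partition_big (fun B : {set T} => inord #|B| : 'I_#|A|.+1) xpredT) //=.
have eqA (i : 'I_#|A|.+1) :
  \sum_(B : {set T} | (B \subset A) && (inord #|B| == i)) (-1) ^+ #|B|
    = (-1) ^+ i *+ 'C(#|A|, i) :> K.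
  rewrite -cards_draws -sumr_const; apply: eq_big => [B|B].
    rewrite inE; apply: andb_id2l => sBA.
    by rewrite -val_eqE /= inordK // ltnS subset_leq_card.
  by case/andP=> sBA /eqP <-; rewrite inordK // ltnS subset_leq_card.
under eq_bigr do rewrite eqA.
transitivity ((1 - 1 : K) ^+ #|A|).
  by rewrite exprDn; apply: eq_bigr => i _; rewrite expr1n mul1r.
by rewrite subrr expr0n cards_eq0.
Qed.

(** Such a C is the union of B and of a subset of the complement of A and B. *)
Lemma card_supersets_avoiding A B a :
    [disjoint A & B] -> (#|B| <= a)%N ->
  #|[set C : {set T} | [&& #|C| == a, [disjoint C & A] & B \subset C]]|
    = 'C(#|T| - #|A| - #|B|, a - #|B|).
Proof.
move=> dAB leBa; have cAB : #|~: (A :|: B)| = (#|T| - #|A| - #|B|)%N.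
  by rewrite cardsCs setCK cardsU (disjoint_setI0 dAB) cards0 subn0 subnDA.
rewrite -cAB -cards_draws.
rewrite -[RHS](@card_in_imset _ _ (fun D => B :|: D)); last first.
  have addK (D : {set T}) : D \subset ~: (A :|: B) -> (B :|: D) :\: B = D.
    rewrite setCU subsetI -!disjoints_subset => /andP[_ dDB].
    by rewrite setDUl setDv set0U; apply/setDidPl.
  move=> D D'; rewrite !inE => /andP[sD _] /andP[sD' _] eqD.
  by rewrite -(addK D sD) eqD addK.
apply: eq_card => C; rewrite inE; apply/and3P/imsetP.
  case=> /eqP <- dCA sBC; exists (C :\: B); last first.
    by rewrite setDE setUIr setUCr setIT (setUidPr sBC).
  rewrite inE cardsD (setIidPr sBC) eqxx andbT.
  by rewrite setCU setDE setSI // -disjoints_subset.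
case=> D; rewrite inE setCU subsetI -!disjoints_subset.
case/andP=> /andP[dDA dDB] /eqP cD ->; split.
- by rewrite cardsU setIC (disjoint_setI0 dDB) cards0 subn0 cD subnKC.
- by rewrite disjoints_subset subUset -!disjoints_subset dDA disjoint_sym dAB.
- exact: subsetUl.
Qed.

(** The kernel of the inverse of the matrix with an entry 1 at each pair of
    disjoint a-subsets. A function f on a-subsets is recovered from
    g B = sum of the f A, A disjoint from B, taken over all B of size at most a:
    inclusion-exclusion gives f A as the sum of (-1)^|B| g B over B inside A.
    In turn g B is, up to the binomial below, the sum of the g C over the
    a-subsets C that contain B. *)
Definition disjointness_inv a A C : K :=
  \sum_(B : {set T} | B \subset A :&: C)
     (-1) ^+ #|B| / ('C(#|T| - a - #|B|, a - #|B|))%:R.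

Lemma disjointness_invC a A C : disjointness_inv a A C = disjointness_inv a C A.
Proof. by rewrite /disjointness_inv setIC. Qed.

(** Exchanging the sums, a subset B of A contributes 0 unless it avoids A', and
    then the binomial in [disjointness_inv] counts the C that contain B and
    avoid A'. What is left is the signed count of the subsets of A outside A',
    which detects A inside A'; for sets of equal size this is equality. The
    bound on a makes the binomials positive. *)
Lemma disjointness_invP a A A' :
    [pchar K] =i pred0 -> (2 * a <= #|T|)%N -> #|A| = a -> #|A'| = a ->
  \sum_(C : {set T} | (#|C| == a) && [disjoint C & A']) disjointness_inv a A C
    = (A == A')%:R.
Proof.
move=> /pcharf0P charK le_aT cA cA'.
rewrite (exchange_big_dep (fun B : {set T} => B \subset A)) /=; last first.
  by move=> C B _; rewrite subsetI => /andP[].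
transitivity (\sum_(B : {set T} | B \subset A :\: A') (-1) ^+ #|B| : K).
  rewrite (bigID (fun B : {set T} => [disjoint B & A'])) /= [X in _ + X]big1.
    rewrite addr0; apply: eq_big => [B|B /andP[sBA dBA']].
      by rewrite setDE subsetI -disjoints_subset.
    have leB : (#|B| <= a)%N by rewrite -cA subset_leq_card.
    rewrite sumr_const -(@eq_card _ [set C : {set T} |
      [&& #|C| == a, [disjoint C & A'] & B \subset C]]) => [|C]; last first.
      by rewrite inE unfold_in /= subsetI sBA andbA.
    rewrite card_supersets_avoiding // 1?disjoint_sym // cA'.
    rewrite -[LHS]mulr_natr mulfVK // charK -lt0n bin_gt0 leq_sub2r //.
    by rewrite -[X in (X <= _)%N](addnK a) leq_sub2r // addnn -mul2n.
  move=> B /andP[sBA ndBA']; apply: big1 => C /andP[/andP[_ dCA']].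
  rewrite subsetI => /andP[_ sBC].
  by case/negP: ndBA'; apply: disjointWl dCA'.
rewrite sum_signed_subsets setD_eq0.
by rewrite [in RHS]eqEcard cA cA' leqnn andbT.
Qed.

(** Applying the left inverse [disjointness_inv] to the vanishing sums returns
    F. *)
Lemma disjointness_inj a (F : {set T} -> K) :
    [pchar K] =i pred0 -> (2 * a <= #|T|)%N ->
    (forall C : {set T}, #|C| = a ->
       \sum_(A : {set T} | (#|A| == a) && [disjoint A & C]) F A = 0) ->
  forall A : {set T}, #|A| = a -> F A = 0.
Proof.
move=> charK le_aT F0 A cA.
pose D A' : K :=
  \sum_(C : {set T} | (#|C| == a) && [disjoint C & A']) disjointness_inv a A C.
have -> : F A = \sum_(A' : {set T} | #|A'| == a) F A' * D A'.
  rewrite (bigD1 A) /= ?cA // [X in _ + X]big1 => [|A' /andP[/eqP cA' neA]].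
    by rewrite /D disjointness_invP // eqxx mulr1 addr0.
  by rewrite /D disjointness_invP // eq_sym (negPf neA) mulr0.
under eq_bigr => A' _ do rewrite mulr_sumr.
rewrite (exchange_big_dep (fun C : {set T} => #|C| == a)) /=; last first.
  by move=> A' C _ /andP[].
apply: big1 => C cC; rewrite -mulr_suml.
under eq_bigl => A' do rewrite cC disjoint_sym.
by rewrite F0 ?mul0r //; apply/eqP.
Qed.

(** Both the disjointness matrix and [disjointness_inv] are symmetric, so the
    left inverse is also a right inverse and gives the solution. *)
Lemma disjointness_surj a (G : {set T} -> K) :
    [pchar K] =i pred0 -> (2 * a <= #|T|)%N ->
  exists F : {set T} -> K, forall C : {set T}, #|C| = a ->
    \sum_(A : {set T} | (#|A| == a) && [disjoint A & C]) F A = G C.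
Proof.
move=> charK le_aT.
exists (fun A =>
  \sum_(C : {set T} | #|C| == a) G C * disjointness_inv a A C) => C cC.
rewrite exchange_big /= (bigD1 C) ?cC //=.
rewrite [X in _ + X]big1 => [|C' /andP[cC' neC]].
  under eq_bigr => A _ do rewrite disjointness_invC.
  by rewrite -mulr_sumr disjointness_invP // eqxx mulr1 addr0.
under eq_bigr => A _ do rewrite disjointness_invC.
by rewrite -mulr_sumr disjointness_invP ?(negPf neC) ?mulr0 //; apply/eqP.
Qed.

End DisjointnessMatrix.

(** * Matchings and the vertices that they cover *)

Section MatchingVertices.

Variable V : finType.
Implicit Types (M N Y : {set edge V}) (S : {set V}).

Definition vertices M : {set V} := \bigcup_(e in M) val e.

Lemma is_matchingP M :
  reflect {in M &, forall e e' : edge V, e != e' -> [disjoint val e & val e']}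
          (is_matching M).
Proof.
apply: (iffP forall_inP) => [matM e e' eM e'M ee'|matM e eM].
  by have /forall_inP/(_ _ e'M)/implyP/(_ ee') := matM _ eM.
by apply/forall_inP => e' e'M; apply/implyP; apply: matM.
Qed.

Lemma is_matchingS N M : N \subset M -> is_matching M -> is_matching N.
Proof.
move=> /subsetP sNM /is_matchingP matM; apply/is_matchingP => e e' eN e'N.
by apply: matM; apply: sNM.
Qed.

Lemma sub_vertices M e : e \in M -> val e \subset vertices M.
Proof. exact: bigcup_sup. Qed.

Lemma is_matchingU N Y :
    is_matching N -> is_matching Y -> [disjoint vertices N & vertices Y] ->
  is_matching (N :|: Y).
Proof.
move=> /is_matchingP matN /is_matchingP matY dNY; apply/is_matchingP => e e'.
case/setUP=> He /setUP[] He'; [exact: matN| | |exact: matY] => _.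
  by apply: disjointW dNY; apply: sub_vertices.
by rewrite disjoint_sym; apply: disjointW dNY; apply: sub_vertices.
Qed.

Lemma disjoint_vertices_sub N M :
  is_matching M -> N \subset M -> [disjoint vertices (M :\: N) & vertices N].
Proof.
move=> /is_matchingP matM /subsetP sNM.
rewrite disjoint_sym bigcup_disjoint // => e /setDP[eM eN].
rewrite disjoint_sym bigcup_disjoint // => e' e'N.
by apply: matM => //; [apply: sNM|apply: contraNneq eN => ->].
Qed.

(** An edge in both sets would put its two endpoints in both vertex sets. *)
Lemma disjoint_vertices N Y :
  [disjoint vertices N & vertices Y] -> [disjoint N & Y].
Proof.
move=> dNY; rewrite -setI_eq0; apply/eqP/setP => e; rewrite !inE.
apply/negP => /andP[eN eY].
have : [disjoint val e & val e] by apply: disjointW dNY; apply: sub_vertices.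
by rewrite -setI_eq0 setIid -cards_eq0 (eqP (valP e)).
Qed.

Lemma card_vertices M : is_matching M -> #|vertices M| = (2 * #|M|)%N.
Proof.
move=> /is_matchingP matM.
have /eqP : trivIset [set val e | e in M].
  apply/trivIsetP => _ _ /imsetP[e eM ->] /imsetP[e' e'M ->].
  by rewrite (inj_eq val_inj); apply: matM.
rewrite cover_imset => <-; rewrite big_imset /=; last first.
  by move=> e e' _ _ /val_inj.
by rewrite mulnC -sum_nat_const; apply: eq_bigr => e _; apply/eqP/(valP e).
Qed.

Lemma card_matching d M : M \in matchings V d -> #|M| = d.
Proof. by rewrite inE => /andP[_ /eqP]. Qed.

Lemma card_matching_vertices d M :
  M \in matchings V d -> #|vertices M| = (2 * d)%N.
Proof. by rewrite inE => /andP[matM /eqP <-]; apply: card_vertices. Qed.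

Lemma vertices_set1 (e : edge V) : vertices [set e] = val e.
Proof. by rewrite /vertices big_set1. Qed.

Lemma is_matching_set1 (e : edge V) : is_matching [set e].
Proof.
by apply/is_matchingP => e1 e2 /set1P-> /set1P->; rewrite eqxx.
Qed.

Lemma verticesU N Y : vertices (N :|: Y) = vertices N :|: vertices Y.
Proof. exact: bigcup_setU. Qed.

(** This lets a condition on all 2d-subsets be tested on d-matchings. *)
Lemma exists_perfect_matching d S :
  #|S| = (2 * d)%N -> exists2 M, M \in matchings V d & vertices M = S.
Proof.
elim: d S => [|d IHd] S cS.
  exists set0; last by rewrite /vertices big_set0 (cards0_eq cS).
  by rewrite inE cards0 eqxx andbT; apply/is_matchingP => e e'; rewrite inE.
have /card_gt1P[a [b [aS bS ab]]] : (1 < #|S|)%N by rewrite cS mulnS.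
have cab : #|[set a; b]| == 2%N by rewrite cards2 ab.
have sabS : [set a; b] \subset S by apply/subsetP => x /set2P[] ->.
pose e : edge V := exist _ [set a; b] cab.
have [|M] := IHd (S :\: [set a; b]).
  by rewrite cardsD (setIidPr sabS) (eqP cab) cS mulnS addKn.
rewrite inE => /andP[matM /eqP cM] vM.
have dM : [disjoint vertices M & vertices [set e]].
  by rewrite vM vertices_set1 disjoints_subset subsetDr.
exists (M :|: [set e]); last first.
  by rewrite verticesU vM vertices_set1 setUC -[RHS](setID S [set a; b])
             (setIidPr sabS).
rewrite inE is_matchingU ?is_matching_set1 //=.
by rewrite cardsU (disjoint_setI0 (disjoint_vertices dM)) cards0 subn0 cM cards1
           addn1.
Qed.

Lemma card_edges_avoiding S :
  #|[set e : edge V | [disjoint val e & S]]| = 'C(#|V| - #|S|, 2).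
Proof.
have <- : #|~: S| = (#|V| - #|S|)%N by rewrite cardsCs setCK.
rewrite -cards_draws -(card_imset _ val_inj); apply: eq_card => A.
rewrite inE -disjoints_subset.
apply/imsetP/andP => [[e + ->]|[dA cA]]; first by rewrite inE (valP e).
by exists (exist _ A cA); rewrite ?inE.
Qed.

(** Removing N is a bijection from the matchings that contain N to the matchings
    that avoid the vertices of N; it turns sums over the former, which the
    coefficients of a multiple of the monomial of N produce, into sums that
    depend on N through its vertices only. *)
Lemma matching_extensions (R : nmodType) d j N (F : {set edge V} -> R) :
    N \in matchings V j ->
  \sum_(M in matchings V (d + j) | N \subset M) F (M :\: N)
    = \sum_(Y in matchings V d | [disjoint vertices Y & vertices N]) F Y.
Proof.
move=> kN; have [matN cN] : is_matching N /\ #|N| = j.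
  by move: kN; rewrite inE => /andP[-> /eqP].
have addK Y : [disjoint vertices Y & vertices N] -> (Y :|: N) :\: N = Y.
  by move=> /disjoint_vertices dYN; rewrite setDUl setDv setU0; apply/setDidPl.
rewrite (reindex_onto (fun Y => Y :|: N) (fun M => M :\: N)) /=; last first.
  move=> M /andP[_ sNM].
  by rewrite setDE setUIl [~: N :|: N]setUC setUCr setIT; apply/setUidPl.
apply: eq_big => [Y|Y /andP[_ /eqP ->] //].
apply/andP/andP => [[/andP[]]|[]].
  rewrite inE => /andP[matYN /eqP cYN] sN /eqP eqY.
  have := disjoint_vertices_sub matYN sN; rewrite eqY => dYN; split=> //.
  rewrite inE (is_matchingS _ matYN) ?subsetUl //=.
  move: cYN; rewrite cardsU (disjoint_setI0 (disjoint_vertices dYN)).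
  by rewrite cards0 subn0 cN => /addIn ->.
rewrite !inE => /andP[matY /eqP cY] dYN; rewrite subsetUr addK // eqxx.
rewrite is_matchingU // cardsU (disjoint_setI0 (disjoint_vertices dYN)).
by rewrite cards0 subn0 cY cN eqxx.
Qed.

End MatchingVertices.

(** * The inverse system of the matching polynomial *)

Section MatchingFunctional.

Variables (K : fieldType) (V : finType).
Implicit Types (M N Y : {set edge V}).
Notation n := #|{: edge V}|.
Implicit Types (f h : {mpoly K[n]}) (m : 'X_{1..n}).
Notation Phi := (matching_poly V K).
Notation l := (edge_sum V K).

Lemma mcoeffMXE f m m' :
  (f * 'X_[m])@_m' = if (m <= m')%MM then f@_(m' - m) else 0.
Proof.
case: ifPn => [le_mm'|nle_mm'].
  by rewrite -[in LHS](submK le_mm') [(_ + m)%MM]addmC mcoeffMX.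
apply/memN_msupp_eq0; apply: contra nle_mm'; rewrite (perm_mem (msuppMX _ _)).
by case/mapP => m0 _ ->; rewrite lem_addr ?lepm_refl.
Qed.

Lemma matching_mnm_le N M :
  (matching_mnm N <= matching_mnm M)%MM = (N \subset M).
Proof.
apply/mnm_lepP/subsetP => [leNM e eN|sNM i].
  by have := leNM (enum_rank e); rewrite !mnmE enum_rankK eN; case: (e \in M).
by rewrite !mnmE; case: (boolP (_ \in N)) => // /sNM ->.
Qed.

Lemma matching_mnmB N M : N \subset M ->
  (matching_mnm M - matching_mnm N)%MM = matching_mnm (M :\: N).
Proof.
move=> /subsetP sNM; apply/mnmP => i; rewrite !mnmE inE.
by case: (boolP (_ \in N)) => [/sNM ->|_]; rewrite /= ?subn0.
Qed.

(** A divisor of a squarefree monomial is squarefree. *)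
Lemma mnm_le_matching m M :
  (m <= matching_mnm M)%MM -> exists N, m = matching_mnm N.
Proof.
move=> /mnm_lepP lemM; exists [set e | m (enum_rank e) != 0%N].
apply/mnmP => i; rewrite !mnmE inE enum_valK.
by have := lemM i; rewrite mnmE; case: (m i) => [|[|j]] //; case: (_ \in M).
Qed.

Lemma mdeg_matching_mnm M : mdeg (matching_mnm M) = #|M|.
Proof.
rewrite mdegE (reindex (@enum_rank {: edge V})) /=; last first.
  by apply: onW_bij; apply: enum_rank_bij.
rewrite -[RHS]sum1_card [RHS]big_mkcond; apply: eq_bigr => e _.
by rewrite mnmE enum_rankK; case: (e \in M).
Qed.

(** Phi_k as a linear form on polynomials: the constant term of h(D)Phi_k, see
    [mcoeff0_diffop]. *)
Definition matching_functional k h : K :=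
  \sum_(M in matchings V k) h@_(matching_mnm M).

Lemma matching_functional_is_scalar k : scalar (matching_functional k).
Proof.
move=> c f h; rewrite /matching_functional mulr_sumr -big_split.
by apply: eq_bigr => M _; rewrite mcoeffD mcoeffZ.
Qed.

HB.instance Definition _ k :=
  GRing.isLinear.Build K {mpoly K[n]} K *%R (matching_functional k)
    (@matching_functional_is_scalar k).

Lemma mcoeff_matching_poly k m :
  (Phi k)@_m = \sum_(M in matchings V k) (matching_mnm M == m)%:R.
Proof.
by rewrite raddf_sum; apply: eq_bigr => M _; rewrite matching_monE /= mcoeffX.
Qed.

(** Only the monomials of Phi_k itself reach degree 0, and their exponents are at
    most 1, so that no factorial appears. *)
Lemma mcoeff0_diffop k h : (diffop h (Phi k))@_0%MM = matching_functional k h.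
Proof.
rewrite raddf_sum /=.
under eq_bigr => m _ do
  rewrite mcoeffZ mcoeff_mderivm addm0 mcoeff_matching_poly -sumrMnl mulr_sumr.
rewrite exchange_big /=; apply: eq_bigr => M _.
have [hM|/memN_msupp_eq0 hM] := boolP (matching_mnm M \in msupp h); last first.
  rewrite hM big_seq big1 // => m hm; case: eqP => [eqm|_]; last first.
    by rewrite mul0rn mulr0.
  by move: hm; rewrite -eqm mcoeff_msupp hM eqxx.
rewrite (big_rem _ hM) /= eqxx [X in _ + X]big_seq [X in _ + X]big1 => [|m].
  rewrite addr0 big1 ?mulr1 // => i _.
  by rewrite mnmE; case: (_ \in M).
rewrite (mem_rem_uniq _ (msupp_uniq h)) inE => /andP[/negPf neq_m _].
by rewrite eq_sym neq_m mul0rn mulr0.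
Qed.

Lemma matching_functional_mulX d j N f :
    N \in matchings V j ->
  matching_functional (d + j) (f * 'X_[matching_mnm N])
    = \sum_(Y in matchings V d | [disjoint vertices Y & vertices N])
        f@_(matching_mnm Y).
Proof.
move=> kN; rewrite -(matching_extensions _ (fun Y => f@_(matching_mnm Y)) kN).
rewrite /matching_functional [RHS]big_mkcondr; apply: eq_bigr => M _.
by rewrite mcoeffMXE matching_mnm_le; case: ifP => // /matching_mnmB ->.
Qed.

(** Multiplying by l is summing over an added edge. Each d-matching Y is reached
    from the edges that avoid its 2d vertices, whose number does not depend
    on Y. *)
Lemma matching_functional_mul_edge_sum d f :
  matching_functional d.+1 (f * l)
    = ('C(#|V| - 2 * d, 2))%:R * matching_functional d f.
Proof.
rewrite mulr_sumr raddf_sum /=.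
have edge_varE (e : edge V) : edge_var K e = 'X_[matching_mnm [set e]].
  by rewrite -matching_monE /matching_mon big_set1.
have ke (e : edge V) : [set e] \in matchings V 1.
  by rewrite inE is_matching_set1 cards1 eqxx.
under eq_bigr => e _ do
  rewrite edge_varE -addn1 (matching_functional_mulX _ _ (ke e)) vertices_set1.
rewrite (exchange_big_dep (fun Y => Y \in matchings V d)) /=; last first.
  by move=> e Y _ /andP[].
rewrite mulr_sumr; apply: eq_bigr => Y kY; rewrite sumr_const mulr_natl.
congr (_ *+ _); rewrite -(card_matching_vertices kY) -card_edges_avoiding.
by apply: eq_card => e; rewrite inE unfold_in /= kY disjoint_sym.
Qed.

Definition lefschetz_const d r : K :=
  (\prod_(i < r) 'C(#|V| - 2 * (d + i), 2))%:R.

Lemma matching_functional_mul_edge_sum_exp d r f :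
  matching_functional (d + r) (f * l ^+ r)
    = lefschetz_const d r * matching_functional d f.
Proof.
rewrite /lefschetz_const; elim: r => [|r IHr].
  by rewrite big_ord0 addn0 expr0 mulr1 mul1r.
rewrite addnS exprSr mulrA matching_functional_mul_edge_sum IHr.
by rewrite big_ord_recr /= natrM mulrA [in RHS](mulrC (_%:R)).
Qed.

Hypothesis charK : [pchar K] =i pred0.

(** The coefficient of h(D)Phi_k at a monomial, multiplied by the factorials of
    the exponents, is the constant term after further differentiation along
    that monomial; in characteristic 0 the factorials can be cancelled. *)
Lemma in_AnnP k h :
  reflect (forall m, matching_functional k (h * 'X_[m]) = 0)
          (h \in Ann (Phi k)).
Proof.
rewrite inE; apply: (iffP eqP) => [hPhi m|hPhi].
  by rewrite -mcoeff0_diffop mulrC diffopM hPhi diffop0r mcoeff0.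
apply/mpolyP => m; rewrite mcoeff0; apply/eqP.
have /eqP := hPhi m.
rewrite -mcoeff0_diffop mulrC diffopM diffopX mcoeff_mderivm addm0 -mulr_natr.
rewrite mulf_eq0 ((pcharf0P _).1 charK) => /orP[] //.
rewrite -leqn0 leqNgt prodn_gt0 // => i.
by rewrite ffactnn fact_gt0.
Qed.

(** For homogeneous f the only multipliers to test in [in_AnnP] are the monomials
    of j-matchings: a monomial that divides no monomial of Phi_(d+j) kills it,
    and one of another degree produces coefficients of f outside degree d. *)
Lemma homog_in_AnnP d j f : f \is d.-homog ->
  reflect
    (forall N, N \in matchings V j ->
       \sum_(Y in matchings V d | [disjoint vertices Y & vertices N])
          f@_(matching_mnm Y) = 0)
    (f \in Ann (Phi (d + j))).
Proof.
move=> homf; apply: (iffP (in_AnnP _ _)) => [evf N kN|evf m].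
  by rewrite -(matching_functional_mulX _ _ kN).
have [N /andP[kN /eqP ->]|noN] :=
    pickP (fun N => (N \in matchings V j) && (m == matching_mnm N)).
  by rewrite (matching_functional_mulX _ _ kN) evf.
apply: big1 => M; rewrite inE => /andP[matM /eqP cM]; rewrite mcoeffMXE.
case: ifP => // lemM; have [N eqm] := mnm_le_matching lemM.
move: lemM; rewrite eqm matching_mnm_le => sNM; rewrite matching_mnmB //.
apply: dhomog_nemf_coeff homf _.
rewrite /= mdeg_matching_mnm cardsD (setIidPr sNM) cM.
apply: contraFneq (noN N) => cMN.
rewrite eqm eqxx andbT inE (is_matchingS sNM matM) /=.
by rewrite -(eqn_add2l d) -[X in (X + _)%N]cMN subnK // -cM subset_leq_card.
Qed.

End MatchingFunctional.

(** * The grading of the quotient by the annihilator of a homogeneous form *)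

Section GorensteinGrading.

Variables (K : fieldType) (n : nat) (p : {mpoly K[n]}) (nz_p : p != 0).
Implicit Types f g : {mpoly K[n]}.
Notation pi := (gorenstein_pi nz_p).

Lemma gorenstein_pi_eq0 f : (pi f == 0) = (f \in Ann p).
Proof. by rewrite -(raddf0 pi) gorenstein_pi_eq subr0. Qed.

Lemma gorenstein_piZ c f : pi (c *: f) = c *: pi f.
Proof. by rewrite -mul_mpolyC rmorphM. Qed.

(** Differentiating along a monomial of degree d lowers degrees by d. On
    coefficients this also covers the case s < d, where f(D)p = 0. *)
Lemma mcoeff_diffop_homog d s f m :
  f \is d.-homog -> p \is s.-homog -> (d + mdeg m != s)%N ->
  (diffop f p)@_m = 0.
Proof.
move=> homf homp nes; rewrite raddf_sum /= big_seq big1 // => m' m'f.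
have dm' : mdeg m' = d := dhomog_mf homf m'f.
rewrite mcoeffZ mcoeff_mderivm (dhomog_nemf_coeff homp) ?mul0rn ?mulr0 //.
by rewrite /= mdegD dm'.
Qed.

(** The homogeneous components of f give the decomposition of its class. It is
    unique because the annihilator of a homogeneous form is homogeneous:
    the polynomials f_d(D)p, for f_d of degree d, lie in different degrees, so
    they vanish separately when their sum does. *)
Lemma graded_gorenstein s :
  p \is s.-homog -> graded_upto s (gorenstein_gr (nz_p := nz_p)).
Proof.
move=> homp.
have over d f : (s < d)%N -> f \is d.-homog -> pi f = 0.
  move=> lt_sd homf; apply/eqP; rewrite gorenstein_pi_eq0 inE; apply/eqP/mpolyP.
  move=> m; rewrite mcoeff0 (mcoeff_diffop_homog homf homp) // gtn_eqF //.
  exact: leq_trans lt_sd (leq_addr _ _).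
split.
- move=> d; split; first by exists 0; rewrite ?dhomog0 ?raddf0.
  move=> c _ _ [f homf ->] [g homg ->]; exists (c *: f + g).
    by apply: dhomogD => //; apply: dhomogZ.
  by rewrite raddfD /= gorenstein_piZ.
- by exists 1; rewrite ?dhomog1 ?rmorph1.
- move=> d e _ _ [f homf ->] [g homg ->].
  exists (f * g); last by rewrite rmorphM.
  exact: dhomogM.
- move=> a; have [f ->] := gorenstein_pi_surj a.
  have eq_f : pi f = \sum_(d < s.+1) pi (pihomog mdeg d f).
    pose r := maxn (msize f) s.+1.
    rewrite {1}(@pihomog_partitionE _ _ mdeg r f) ?leq_maxl // raddf_sum /=.
    rewrite [RHS](big_ord_widen r (fun d => pi (pihomog mdeg d f))) ?leq_maxr //.
    rewrite [RHS]big_mkcond; apply: eq_bigr => d _; case: ltnP => // lt_sd.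
    exact: over lt_sd (pihomogP mdeg d f).
  exists [ffun d : 'I_s.+1 => pi (pihomog mdeg d f)]; split.
    split=> [d|].
      by rewrite ffunE; exists (pihomog mdeg d f); rewrite ?pihomogP.
    by rewrite eq_f; apply: eq_bigr => d _; rewrite ffunE.
  move=> c [homc eq_c]; have [g homg cE] := fin_all_exists2 homc.
  apply/ffunP => d; rewrite ffunE cE; apply/eqP.
  rewrite -subr_eq0 -raddfB gorenstein_pi_eq0 inE; apply/eqP/mpolyP => m.
  pose h (i : 'I_s.+1) := pihomog mdeg i f - g i.
  have homh (i : 'I_s.+1) : h i \is i.-homog by rewrite rpredB ?pihomogP.
  have [eqs|nes] := eqVneq (d + mdeg m)%N s; last first.
    by rewrite mcoeff0; apply: mcoeff_diffop_homog (homh d) homp nes.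
  (* Only the component of degree d contributes to the coefficient at m. *)
  have /eqP <- : diffop (\sum_i h i) p == 0.
    rewrite -[_ == _]/(_ \in Ann p) -gorenstein_pi_eq0 raddf_sum /=.
    under eq_bigr => i _ do rewrite raddfB /= -cE.
    by rewrite big_split sumrN /= -eq_f -eq_c subrr.
  rewrite diffop_suml (bigD1 d) //= mcoeffD [X in _ = _ + X]raddf_sum /=.
  rewrite [X in _ = _ + X]big1 ?addr0 // => i ne_id.
  apply: mcoeff_diffop_homog (homh i) homp _.
  by rewrite -[X in _ != X]eqs eqn_add2r val_eqE.
- by move=> d _ lt_sd [f homf ->]; apply: over homf.
Qed.

End GorensteinGrading.

(** * Multiplication by powers of the sum of the edge variables *)

Section MatchingLefschetz.

Variables (K : fieldType) (V : finType).
Hypothesis charK : [pchar K] =i pred0.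
Notation n := #|{: edge V}|.
Implicit Types (f g : {mpoly K[n]}).
Notation Phi := (matching_poly V K).
Notation l := (edge_sum V K).

Lemma matching_poly_homog k : Phi k \is k.-homog.
Proof.
apply: rpred_sum => M kM.
by rewrite matching_monE dhomogX /= mdeg_matching_mnm (card_matching kM).
Qed.

Lemma edge_sum_exp_homog r : l ^+ r \is r.-homog.
Proof.
rewrite -[X in X.-homog]mul1n; apply: dhomogMn; apply: rpred_sum => e _.
by rewrite dhomogX /= mdeg1.
Qed.

Lemma lefschetz_const_neq0 d r :
  (2 * (d + r) <= #|V|)%N -> lefschetz_const K V d r != 0.
Proof.
move=> le_dr; rewrite (pcharf0P _).1 // -lt0n prodn_gt0 // => i.
by rewrite bin_gt0; have := ltn_ord i; lia.
Qed.

(** l^k pairs to a nonzero multiple of the value of the functional of Phi_0 = 1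
    at 1. This makes all the components of degree at most k nonzero, since
    they contain the divisors l^d of l^k. *)
Lemma edge_sum_exp_notin_Ann k :
  (2 * k <= #|V|)%N -> l ^+ k \notin Ann (Phi k).
Proof.
move=> le_kV; apply/negP => /in_AnnP - /(_ charK 0%MM)/eqP.
rewrite mpolyX0 mulr1 -[l ^+ k]mul1r -[X in matching_functional X]add0n.
rewrite matching_functional_mul_edge_sum_exp mulf_eq0.
rewrite (negPf (lefschetz_const_neq0 _)) //=.
rewrite /matching_functional (big_pred1 set0) => [|M].
  rewrite mcoeff1 -mdeg_eq0 mdeg_matching_mnm cards0 eqxx.
  by apply/negP; rewrite oner_eq0.
rewrite inE cards_eq0 /= andbC; case: (M =P set0) => // ->.
by apply/is_matchingP => e e'; rewrite inE.
Qed.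

(** Pairing f l^r with d-matchings shows that F, defined below, is in the kernel
    of the disjointness matrix; pairing f with the matchings of complementary
    degree d + r involves F only. *)
Lemma mul_edge_sum_inj d r f :
    (2 * (d + d + r) <= #|V|)%N -> f \is d.-homog ->
  f * l ^+ r \in Ann (Phi (d + d + r)) -> f \in Ann (Phi (d + d + r)).
Proof.
move=> le_V homf flr.
pose F (A : {set V}) := \sum_(Y in matchings V d | vertices Y == A)
  f@_(matching_mnm Y).
have sumF C :
  \sum_(A : {set V} | (#|A| == (2 * d)%N) && [disjoint A & C]) F A
    = \sum_(Y in matchings V d | [disjoint vertices Y & C]) f@_(matching_mnm Y).
  rewrite [RHS](partition_big (@vertices V)
    (fun A => (#|A| == (2 * d)%N) && [disjoint A & C])) /=; last first.
    by move=> Y /andP[/card_matching_vertices -> ->]; rewrite eqxx.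
  apply: eq_bigr => A /andP[_ dA]; apply: eq_bigl => Y.
  by case: eqP => [->|_]; rewrite ?dA ?andbT ?andbF.
have le_dV : (2 * (2 * d) <= #|V|)%N by lia.
have F0 : forall A : {set V}, #|A| = (2 * d)%N -> F A = 0.
  apply: (disjointness_inj charK le_dV) => C cC; rewrite sumF.
  have [N kN vN] := exists_perfect_matching cC.
  rewrite -vN -(matching_functional_mulX _ _ kN); apply/eqP.
  have /in_AnnP - /(_ charK (matching_mnm N))/eqP := flr.
  rewrite mulrAC matching_functional_mul_edge_sum_exp mulf_eq0.
  by rewrite (negPf (lefschetz_const_neq0 _)).
rewrite -addnA; apply/(homog_in_AnnP charK _ homf) => N _; rewrite -sumF.
by apply: big1 => A /andP[/eqP/F0].
Qed.

(** An element of degree d + r is determined by its pairings with d-matchings, so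
    it suffices that f l^r has the same ones as g. One d-matching for each
    2d-set of vertices is enough to build f: its coefficients solve the linear
    system given by the disjointness matrix. *)
Lemma mul_edge_sum_surj d r g :
    (2 * (d + d + r) <= #|V|)%N -> g \is (d + r).-homog ->
  exists2 f, f \is d.-homog & f * l ^+ r - g \in Ann (Phi (d + d + r)).
Proof.
move=> le_V homg; have le_dV : (2 * (2 * d) <= #|V|)%N by lia.
have nz_c : lefschetz_const K V (d + d) r != 0 by apply: lefschetz_const_neq0.
pose G (C : {set V}) := (lefschetz_const K V (d + d) r)^-1 *
  \sum_(Y in matchings V (d + r) | [disjoint vertices Y & C])
     g@_(matching_mnm Y).
have [F FG] := disjointness_surj G charK le_dV.
have /fin_all_exists [mt mtP] : forall A : {set V}, exists M,
    #|A| = (2 * d)%N -> M \in matchings V d /\ vertices M = A.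
  move=> A; have [/eqP/exists_perfect_matching [M kM vM]|ncA] :=
    boolP (#|A| == (2 * d)%N); first by exists M.
  by exists set0 => /eqP; rewrite (negPf ncA).
pose f :=
  \sum_(A : {set V} | #|A| == (2 * d)%N) F A *: 'X_[K, matching_mnm (mt A)].
have homf : f \is d.-homog.
  apply: rpred_sum => A /eqP/mtP[kM _]; apply: dhomogZ.
  by rewrite dhomogX /= mdeg_matching_mnm (card_matching kM).
exists f => //.
have homh : f * l ^+ r - g \is (d + r).-homog.
  by rewrite rpredB //; apply: dhomogM homf (edge_sum_exp_homog r).
have Edr : (d + d + r = d + r + d)%N by lia.
rewrite Edr; apply/(homog_in_AnnP charK _ homh) => N kN.
rewrite -(matching_functional_mulX _ _ kN) mulrBl raddfB /= -Edr mulrAC.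
rewrite matching_functional_mul_edge_sum_exp.
rewrite Edr !(matching_functional_mulX _ _ kN).
apply/eqP; rewrite subr_eq0; apply/eqP.
have -> : \sum_(Y in matchings V d | [disjoint vertices Y & vertices N])
    f@_(matching_mnm Y) = G (vertices N).
  rewrite -FG ?(card_matching_vertices kN) //.
  under eq_bigr => Y _ do rewrite raddf_sum /=.
  rewrite exchange_big /= [RHS]big_mkcondr; apply: eq_bigr => A /eqP/mtP[kM vM].
  under eq_bigr => Y _ do
    rewrite mcoeffZ mcoeffX (inj_eq (@matching_mnm_inj _)) eq_sym
            mulr_natr mulrb.
  rewrite -big_mkcondr /=; case: ifPn => dA.
    apply: (big_pred1 (mt A)) => Y /=.
    by case: eqP => [->|_]; rewrite ?andbF // kM vM dA.
  apply: big_pred0 => Y.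
  by case: eqP => [->|_]; rewrite ?andbF // vM (negPf dA) andbF.
by rewrite mulrA divff // mul1r.
Qed.

Lemma matching_algebra_strong_Lefschetz k (le_kV : (2 * k <= #|V|)%N) :
  let nz := matching_poly_neq0 K le_kV in
  strong_Lefschetz k (gorenstein_gr (nz_p := nz)) (gorenstein_pi nz l).
Proof.
move=> nz; split.
- exact/graded_gorenstein/matching_poly_homog.
- move=> d le_dk; exists (gorenstein_pi nz (l ^+ d)).
    by exists (l ^+ d); rewrite ?edge_sum_exp_homog.
  apply: contra (edge_sum_exp_notin_Ann le_kV) => ld0.
  have -> : l ^+ k = l ^+ (k - d) * l ^+ d by rewrite -exprD subnK.
  by rewrite -(gorenstein_pi_eq0 nz) rmorphM /= (eqP ld0) mulr0.
- by exists l; rewrite // -[l]expr1 edge_sum_exp_homog.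
- move=> d le_dk.
  have [r def_r] : exists r, r = (k - 2 * d)%N by exists (k - 2 * d)%N.
  have Ek : k = (d + d + r)%N by rewrite def_r addnn -mul2n subnKC.
  have Ekd : (k - d = d + r)%N by rewrite [in LHS]Ek -addnA addKn.
  have le_V : (2 * (d + d + r) <= #|V|)%N by rewrite -Ek.
  rewrite -def_r -rmorphXn; split.
  + move=> _ [f homf ->]; exists (f * l ^+ r); last by rewrite rmorphM.
    by rewrite Ekd; apply: dhomogM homf (edge_sum_exp_homog r).
  + move=> _ _ [f homf ->] [g homg ->] /eqP.
    rewrite -!rmorphM gorenstein_pi_eq -mulrBl => fg; apply/eqP.
    rewrite gorenstein_pi_eq; move: fg; rewrite Ek.
    by apply: mul_edge_sum_inj; rewrite ?rpredB.
  + move=> _ [g homg ->]; move: homg; rewrite Ekd => homg.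
    have [f homf fg] := mul_edge_sum_surj le_V homg.
    exists (gorenstein_pi nz f); first by exists f.
    by apply/eqP; rewrite -rmorphM gorenstein_pi_eq Ek.
Qed.

End MatchingLefschetz.

Theorem theorem3p1 (K : fieldType) (charK : [pchar K] =i pred0)
    (U : {fset int}) (U_neq0 : U != fset0)
    (k : nat) (le_kU : (2 * k <= #|{: U}|)%N) :
  let nz := matching_poly_neq0 K le_kU in
  strong_Lefschetz k (gorenstein_gr (nz_p := nz))
    (gorenstein_pi nz (edge_sum U K)).
Proof. exact: matching_algebra_strong_Lefschetz. Qed.
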